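(* Let $\mathcal{D}\in\mathbb{R}^{m\times n}$ be a matrix with $\operatorname{rank}(\mathcal{D})=r\le\min\{m,n\}$, and let $J\in\mathbb{R}^{n\times(n-r)}$ and the dictionary $\mathcal{X}$ be obtained from $\mathcal{D}$ by the construction described in the context. Let $p$ be the number of columns of $\begin{bmatrix}J&\mathcal{X}\end{bmatrix}$. Then for every $Y\in\mathbb{R}^n$ and every $\lambda>0$, $$\hat f_{\mathrm A}:=\arg\min_{f\in\mathbb{R}^n}\left\{\|Y-f\|_n^2+2\lambda\|\mathcal{D}f\|_1\right\}=\begin{bmatrix}J&\mathcal{X}\end{bmatrix}\arg\min_{\beta\in\mathbb{R}^p}\left\{\left\|Y-\begin{bmatrix}J&\mathcal{X}\end{bmatrix}\beta\right\|_n^2+2\lambda\|\beta_{-[n-r]}\|_1\right\}.$$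
   Context: For $v\in\mathbb{R}^n$, $\|v\|_n^2=\|v\|_2^2/n$. $\beta_{-[n-r]}$ is the vector $\beta$ with its first $n-r$ entries removed (the coefficients of the columns of $J$, which are not penalized). The right-hand side is understood as the vector $\begin{bmatrix}J&\mathcal{X}\end{bmatrix}\hat\beta$ for any minimizer $\hat\beta$. $\mathcal{N}(M)$ denotes the nullspace of $M$; $\mathcal{D}_T$ is the submatrix of $\mathcal{D}$ consisting of the rows with index in $T$. Construction of $J$ and $\mathcal{X}$: 1. Find all sets $T_i\subseteq\{1,\dots,m\}$ with $|T_i|=r$ and $\operatorname{rank}(\mathcal{D}_{T_i})=r$. 2. Choose $n-r$ row vectors spanning $\mathcal{N}(\mathcal{D})$ (which equals $\mathcal{N}(\mathcal{D}_{T_i})$ for all $i$) and write them as the rows of $A\in\mathbb{R}^{(n-r)\times n}$. 3. For every $i$, invert $B_i=\begin{pmatrix}A\\ \mathcal{D}_{T_i}\end{pmatrix}$ and write $B_i^{-1}=\begin{pmatrix}J&\tilde{\mathcal{X}}^i\end{pmatrix}$ with $J\in\mathbb{R}^{n\times(n-r)}$, $\tilde{\mathcal{X}}^i\in\mathbb{R}^{n\times r}$ ($J$ is the same for all $i$). 4. Let $\tilde{\mathcal{X}}$ collect the columns of all the $\tilde{\mathcal{X}}^i$. 5. Rescale every column $\tilde x$ of $\tilde{\mathcal{X}}$ to $\tilde x/\|\mathcal{D}\tilde x\|_1$, obtaining $\mathcal{X}$. 6. Prune $\mathcal{X}$: as long as there is a column $\mathcal{X}_k$ of the current matrix lying in the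 convex hull of the vectors $\pm\mathcal{X}_l$, $l\ne k$ (over the other current columns; the convex hull of the empty set is empty), discard such a column, one at a time. 7. The resulting matrix is the dictionary $\mathcal{X}$. *)

(* Defs.v *)
From mathcomp Require Import all_boot all_order all_algebra.
From mathcomp Require Import classical_sets reals.

Set Implicit Arguments.
Unset Strict Implicit.
Unset Printing Implicit Defensive.

Import Order.TTheory GRing.Theory Num.Theory.

Local Open Scope ring_scope.
Local Open Scope classical_set_scope.

Section Dictionary.
Variable R : realType.

Definition l1norm n (v : 'cV[R]_n) : R := \sum_(i < n) `|v i 0|.

(* the squared scaled Euclidean norm ||v||_n^2 = ||v||_2^2 / n *)
Definition sqnormn n (v : 'cV[R]_n) : R := (\sum_(i < n) v i 0 ^+ 2) / n%:R.

Definition argmin (T : Type) (F : T -> R) : set T :=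
  [set x | forall y, F x <= F y].

(* No family indexed by 'I_0 has weights summing to 1, so conv_hull set0 is
   empty. *)
Definition conv_hull (V : lmodType R) (S : set V) : set V :=
  [set x | exists (N : nat) (w : 'I_N -> R) (v : 'I_N -> V),
     [/\ forall i, 0 <= w i, \sum_(i < N) w i = 1, forall i, S (v i)
       & x = \sum_(i < N) w i *: v i]].

Definition columns n q (M : 'M[R]_(n, q)) : seq 'cV[R]_n :=
  [seq col j M | j <- enum 'I_q].

Definition row_submx m n (D : 'M[R]_(m, n)) (T : {set 'I_m}) : 'M[R]_(#|T|, n) :=
  rowsub (@enum_val _ (mem T)) D.

Definition row_bases m n (D : 'M[R]_(m, n)) (r : nat) : {set {set 'I_m}} :=
  [set T : {set 'I_m} | (#|T| == r) && (\rank (row_submx D T) == r)]%SET.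

(* [is_inverse_blocks A B J X]: the matrix with row blocks A, B is invertible
   and its inverse has column blocks J, X. The heights k and l of the blocks
   add up to n only propositionally, so invmx does not apply. *)
Definition is_inverse_blocks n k l (A : 'M[R]_(k, n)) (B : 'M[R]_(l, n))
    (J : 'M[R]_(n, k)) (X : 'M[R]_(n, l)) : Prop :=
  row_mx J X *m col_mx A B = 1%:M /\ col_mx A B *m row_mx J X = 1%:M.

Definition rescale m n (D : 'M[R]_(m, n)) (x : 'cV[R]_n) : 'cV[R]_n :=
  (l1norm (D *m x))^-1 *: x.

(* Columns are discarded by position: of two equal columns, either one lies in
   the hull of the other and may be discarded. *)
Definition prune_step n (s t : seq 'cV[R]_n) : Prop :=
  exists (s1 s2 : seq 'cV[R]_n) (x : 'cV[R]_n),
    [/\ s = s1 ++ x :: s2, t = s1 ++ s2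
      & conv_hull [set y | y \in t \/ - y \in t] x].

Inductive prunes_to n : seq 'cV[R]_n -> seq 'cV[R]_n -> Prop :=
| PruneStop s : (forall t, ~ prune_step s t) -> prunes_to s s
| PruneDiscard s t u : prune_step s t -> prunes_to t u -> prunes_to s u.

(* J and X are a possible outcome of the construction applied to D of rank r.
   The choices left open are the basis A of the nullspace of D, the order of
   the columns and the columns discarded. The rows of [kermx D^T] span
   {u | u *m D^T = 0}, that is, the transposes of the v with D *m v = 0. *)
Definition is_dictionary m n r (D : 'M[R]_(m, n))
    (J : 'M[R]_(n, n - r)) q (X : 'M[R]_(n, q)) : Prop :=
  exists (A : 'M[R]_(n - r, n)) (Xt : forall T : {set 'I_m}, 'M[R]_(n, #|T|))
         (s : seq 'cV[R]_n),
    [/\ (A == kermx D^T)%MS,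
        forall T, T \in row_bases D r ->
          is_inverse_blocks A (row_submx D T) J (Xt T),
        perm_eq s (flatten [seq columns (Xt T) | T <- enum (row_bases D r)])
      & prunes_to (map (rescale D) s) (columns X)].

End Dictionary.

(* Main.v *)
Require Import Defs.
From mathcomp Require Import all_boot all_order all_algebra.
From mathcomp Require Import classical_sets reals.
From mathcomp Require Import topology normedtype derive.
From mathcomp Require Import ring lra.

Set Implicit Arguments.
Unset Strict Implicit.
Unset Printing Implicit Defensive.

Import Order.TTheory GRing.Theory Num.Theory.
Local Open Scope ring_scope.
Local Open Scope classical_set_scope.

(** The two problems agree because [l1norm (D *m f)] is the smallest penalty
    [l1norm (dsubmx b)] among the coefficient vectors [b] with
    [row_mx J X *m b = f].  Hence a minimizer of one objective yields one of
    the other, and the analysis objective has exactly one minimizer.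

    No representation is cheaper ([dictionary_analysis_le]): [D] kills [J], and
    a rescaled column [x] has [l1norm (D *m x) <= 1], so the triangle inequality
    applies.

    Some representation is that cheap ([dictionary_synthesis]).  Whenever
    [D *m f] is nonzero, some column [x] of one of the inverses has [D *m x]
    nonzero and supported where [D *m f] is ([exists_atom_in_support]): extend
    an independent set of rows spanning the rows that vanish at [f] to a row
    basis, and take the column dual to an added row that does not vanish.
    Moving [f] along [x] until a nonzero coordinate of [D *m f] first vanishes
    reverses no sign, so the l1 norm is affine along the move, and the support
    shrinks.
    If such moves exist in both directions, [f] is a convex combination of the
    two end points; otherwise [D *m x] has the signs of plus or minus [D *m f]
    and [f] splits as an end point plus a multiple of [x].  In both cases the
    penalties add up to exactly [l1norm (D *m f)], and induction on the support
    ends at [D *m f = 0], where [f] is a combination of columns of [J]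
    ([conformal_decomposition]).  A pruned column is in the symmetric convex
    hull of the remaining ones, so it can be replaced at no extra cost
    ([prunes_to_hull]).

    Existence of the minimizer is compactness of a box outside of which the
    objective exceeds its value at [Y]; uniqueness is strict convexity of the
    quadratic term ([objective_min], [objective_min_unique]). *)

(** * Independent sets of rows *)

Section RowBases.
Variables (R : realType) (m n : nat) (D : 'M[R]_(m, n)).
Implicit Types (T Z : {set 'I_m}) (x : 'cV[R]_n).

Definition independent_rows T := \rank (row_submx D T) == #|T|.

Lemma row_row_submx T i : i \in T -> exists j, row j (row_submx D T) = row i D.
Proof.
move=> iT; exists (enum_rank_in iT i).
by rewrite row_rowsub enum_rankK_in.
Qed.

Lemma row_submx_subP T k (M : 'M[R]_(k, n)) :
  reflect {in T, forall i, (row i D <= M)%MS} (row_submx D T <= M)%MS.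
Proof.
apply: (iffP row_subP) => [TM i /row_row_submx[j <-]|TM j]; first exact: TM.
by rewrite row_rowsub; apply: TM; apply: enum_valP.
Qed.

Lemma row_submxS T Z : T \subset Z -> (row_submx D T <= row_submx D Z)%MS.
Proof.
move=> /fintype.subsetP TZ; apply/row_submx_subP => i /TZ /row_row_submx[j <-].
exact: row_sub.
Qed.

Lemma row_submx_mul0P T x :
  reflect {in T, forall i, (D *m x) i 0 = 0} (row_submx D T *m x == 0).
Proof.
rewrite /row_submx mul_rowsub_mx; apply: (iffP eqP) => [Dx0 i iT|Dx0].
  have /(congr1 (fun v : 'cV_ _ => v (enum_rank_in iT i) 0)) := Dx0.
  by rewrite !mxE enum_rankK_in.
by apply/colP => j; rewrite [LHS]mxE Dx0 ?mxE ?enum_valP.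
Qed.

(** A maximal independent set between [T] and [Z] spans all rows of [Z], since
    adding a row outside the span would raise the rank. *)
Lemma independent_rows_extend T Z :
    independent_rows T -> T \subset Z ->
  exists S, [/\ independent_rows S, T \subset S, S \subset Z
              & (row_submx D Z <= row_submx D S)%MS].
Proof.
move=> indT TZ; pose P (S : {set 'I_m}) := independent_rows S && (S \subset Z).
have [S maxS TS] : {S | maxset P S & T \subset S}.
  by apply: maxset_exists; rewrite /P indT.
have /andP[indS SZ] := maxsetp maxS; exists S; split=> //.
apply/row_submx_subP => i iZ; apply: contraT => iNS.
have iS : i \notin S.
  by apply: contraNN iNS => /row_row_submx[j <-]; apply: row_sub.
have ltS : (row_submx D S < row_submx D (i |: S)%SET)%MS.
  rewrite ltmxE row_submxS ?finset.subsetUr //=.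
  apply: contra iNS.
  by move/row_submx_subP; apply; rewrite !inE eqxx.
have PiS : P (i |: S)%SET.
  rewrite /P finset.subUset finset.sub1set iZ SZ /independent_rows eqn_leq.
  rewrite rank_leq_row !andbT /=.
  apply: leq_trans (rank_ltmx ltS).
  by rewrite cardsU1 iS add1n ltnS (eqP indS).
have iSS := (maxsetP maxS).2 _ PiS (finset.subsetUr _ _).
by rewrite -iSS !inE eqxx in iS.
Qed.

(** A row basis adapted to [Z]: the part of it inside [Z] already spans the rows
    of [Z].  It comes from two extensions, first inside [Z], then inside the
    set of all rows. *)
Lemma row_bases_extend (r : nat) Z : \rank D = r ->
  exists2 T, T \in row_bases D r
    & (row_submx D Z <= row_submx D (Z :&: T)%SET)%MS.
Proof.
move=> rankD.
have ind0 : independent_rows finset.set0.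
  rewrite /independent_rows eqn_leq rank_leq_row /=.
  by apply: leq_trans (leq0n _); rewrite cards0.
have [B [indB _ BZ ZB]] := independent_rows_extend ind0 (finset.sub0set Z).
have [T [indT BT _ DT]] := independent_rows_extend indB (finset.subsetT B).
exists T; last first.
  by apply: submx_trans ZB (row_submxS _); rewrite finset.subsetI BZ.
rewrite inE (eqP indT) andbb -(eqP indT) -rankD eqn_leq.
rewrite mxrankS /=; last by apply/row_submx_subP => i _; apply: row_sub.
apply: mxrankS; apply: submx_trans DT.
apply/row_subP => i; have [j <-] := row_row_submx (finset.in_setT i).
exact: row_sub.
Qed.

End RowBases.

(** * Columns of the inverses as sparse directions *)

Section Atoms.
Variables (R : realType) (m n r : nat) (D : 'M[R]_(m, n)).
Hypothesis rankD : \rank D = r.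

Lemma inverse_blocksP k l (A : 'M[R]_(k, n)) (B : 'M[R]_(l, n)) J X :
    is_inverse_blocks A B J X ->
  [/\ J *m A + X *m B = 1%:M, B *m J = 0 & B *m X = 1%:M].
Proof.
case; rewrite mul_row_col mul_col_row scalar_mx_block => -> /eq_block_mx.
by case.
Qed.

Lemma row_bases_ker T x :
  T \in row_bases D r -> row_submx D T *m x = 0 :> 'cV_ _ -> D *m x = 0.
Proof.
rewrite inE => /andP[_ /eqP rankT].
have TD : (row_submx D T <= D)%MS.
  by apply/row_submx_subP => i _; apply: row_sub.
have := mxrank_leqif_sup TD; rewrite rankT rankD => -[_].
rewrite eqxx => /esym/submxP[K DK] Tx0.
by rewrite DK -mulmxA Tx0 mulmx0.
Qed.

(** With [Z] the zero set of [D *m f] and [T] a row basis adapted to [Z], some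
    [i] of [T] lies outside [Z], as otherwise [D *m f] would vanish.  The column
    dual to [i] is annihilated by the other rows of [T], hence by those in
    [Z :&: T], which span all rows of [Z]. *)
Lemma exists_atom_in_support (A : 'M[R]_(n - r, n)) (J : 'M[R]_(n, n - r))
    (Xt : forall T : {set 'I_m}, 'M[R]_(n, #|T|)) (f : 'cV[R]_n) :
    (forall T, T \in row_bases D r ->
       is_inverse_blocks A (row_submx D T) J (Xt T)) ->
    D *m f != 0 ->
  exists2 T, T \in row_bases D r & exists j : 'I_#|T|,
    D *m col j (Xt T) != 0 /\
    forall i, (D *m f) i 0 = 0 -> (D *m col j (Xt T)) i 0 = 0.
Proof.
move=> invX Df0; pose Z := [set i | (D *m f) i 0 == 0]%SET.
have [T Tbase ZT] := row_bases_extend Z rankD; exists T => //.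
have /subsetPn[i iT iZ] : ~~ (T \subset Z).
  apply: contra Df0 => /fintype.subsetP TZ.
  apply/eqP/(row_bases_ker Tbase)/eqP/row_submx_mul0P => i /TZ.
  by rewrite inE => /eqP.
pose j := enum_rank_in iT i; exists j.
have [_ _ TX] := inverse_blocksP (invX T Tbase).
have Dx k : k \in T -> (D *m col j (Xt T)) k 0 = (k == i)%:R.
  move=> kT; have := congr1 (fun M : 'M_ _ => M (enum_rank_in iT k) j) TX.
  rewrite /row_submx mul_rowsub_mx colE mulmxA -colE.
  rewrite [X in X = _ -> _]mxE enum_rankK_in // [RHS in _ -> RHS = _]mxE => ->.
  by rewrite mxE (can_in_eq (enum_rankK_in iT)).
split.
  apply/eqP => /colP/(_ i); rewrite Dx // eqxx mxE => /eqP.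
  by rewrite oner_eq0.
have /eqP : row_submx D (Z :&: T)%SET *m col j (Xt T) = 0.
  apply/eqP/row_submx_mul0P => k; rewrite inE => /andP[kZ kT].
  by rewrite Dx //; case: eqP => // ki; rewrite -ki kZ in iZ.
move=> /eqP Zx0; have /row_submx_mul0P Dx0 : row_submx D Z *m col j (Xt T) == 0.
  by have [K ->] := submxP ZT; rewrite -mulmxA Zx0 mulmx0.
by move=> k /eqP fk0; apply: Dx0; rewrite inE.
Qed.

End Atoms.

(** * The l1 norm along a line *)

Section Conformal.
Variable R : realType.

Lemma l1norm0 m : l1norm (0 : 'cV[R]_m) = 0.
Proof. by rewrite /l1norm big1 // => i _; rewrite mxE normr0. Qed.

Lemma l1normZ m a (v : 'cV[R]_m) : l1norm (a *: v) = `|a| * l1norm v.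
Proof.
by rewrite /l1norm mulr_sumr; apply: eq_bigr => i _; rewrite mxE normrM.
Qed.

Lemma ler_l1normD m (u v : 'cV[R]_m) : l1norm (u + v) <= l1norm u + l1norm v.
Proof.
by rewrite /l1norm -big_split; apply: ler_sum => i _; rewrite mxE ler_normD.
Qed.

Lemma l1norm_ge0 m (v : 'cV[R]_m) : 0 <= l1norm v.
Proof. by apply: sumr_ge0 => i _; apply: normr_ge0. Qed.

Lemma l1norm_eq0 m (v : 'cV[R]_m) : l1norm v = 0 -> v = 0.
Proof.
move/eqP; rewrite psumr_eq0 => [/allP v0|i _]; last exact: normr_ge0.
apply/colP => i; apply/eqP; rewrite mxE -normr_eq0.
by apply: (implyP (v0 i _)); rewrite ?mem_index_enum.
Qed.

(** The directional derivative of [l1norm] at [v] along [u], provided that the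
    support of [u] is contained in that of [v]. *)
Definition slope m (u v : 'cV[R]_m) : R := \sum_i Num.sg (v i 0) * u i 0.

Lemma slopeN m (u v : 'cV[R]_m) : slope (- u) v = - slope u v.
Proof. by rewrite -sumrN; apply: eq_bigr => i _; rewrite mxE mulrN. Qed.

Lemma l1norm_line m (u v : 'cV[R]_m) t :
    (forall i, v i 0 = 0 -> u i 0 = 0) ->
    (forall i, 0 <= v i 0 * (v i 0 + t * u i 0)) ->
  l1norm (v + t *: u) = l1norm v + t * slope u v.
Proof.
move=> supp_uv same_sign; rewrite /l1norm /slope mulr_sumr -big_split /=.
apply: eq_bigr => i _; rewrite !mxE; have := same_sign i; have := supp_uv i.
case: (ltrgt0P (v i 0)) => [v_gt0|v_lt0|->] supp_i.
- by rewrite pmulr_rge0 // => /ger0_norm ->; rewrite gtr0_sg // mul1r.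
- rewrite nmulr_rge0 // => /ler0_norm ->; rewrite ltr0_sg // mulN1r; lra.
- by rewrite supp_i // !mulr0 addr0 normr0.
Qed.

(** The first time at which a nonzero coordinate of [v] reaches zero along
    [v + t *: u]: the minimum of [- (v i 0 / u i 0)] over the coordinates that
    move towards zero. *)
Lemma exit_time m (u v : 'cV[R]_m) i0 : v i0 0 * u i0 0 < 0 ->
  exists2 t, 0 < t
    & (forall i, 0 <= v i 0 * (v i 0 + t * u i 0)) /\
      exists2 i, v i 0 != 0 & v i 0 + t * u i 0 = 0.
Proof.
pose s i := v i 0 * u i 0 => s0.
have [k sk mink] := @arg_minP _ _ _ i0 (fun i => s i < 0)
  (fun i => - (v i 0 / u i 0)) s0.
have uk0 : u k 0 != 0 by apply: contraTneq sk => uk; rewrite /s uk mulr0 ltxx.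
have vk0 : v k 0 != 0 by apply: contraTneq sk => vk; rewrite /s vk mul0r ltxx.
have quot i : u i 0 != 0 -> v i 0 / u i 0 = s i / u i 0 ^+ 2.
  by move=> ui0; rewrite /s; field.
exists (- (v k 0 / u k 0)).
  rewrite oppr_gt0 quot // pmulr_llt0 // invr_gt0.
  by rewrite exprn_even_gt0.
split; last by exists k => //; rewrite mulNr divfK // subrr.
move=> i; rewrite mulrDr mulrCA -/(s i).
have [si|si] := ltP (s i) 0; last first.
  rewrite addr_ge0 -?expr2 ?sqr_ge0 // mulr_ge0 // oppr_ge0 quot //.
  by rewrite mulr_le0_ge0 ?(ltW sk) // invr_ge0 sqr_ge0.
have ui0 : u i 0 != 0 by apply: contraTneq si => ui; rewrite /s ui mulr0 ltxx.
have := mink i si; rewrite -(ler_nM2r si) => le_t.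
apply: le_trans (lerD (lexx _) le_t).
by rewrite le_eqVlt; apply/orP; left; apply/eqP; rewrite /s; field.
Qed.

End Conformal.

(** * Decomposition into atoms without loss of l1 norm *)

(** [P c f] stands for: [f] can be represented at cost at most [c]. *)
Section Decomposition.
Variables (R : realType) (m n : nat) (D : 'M[R]_(m, n)).
Variable P : R -> 'cV[R]_n -> Prop.
Hypothesis P_add : forall c d f g, P c f -> P d g -> P (c + d) (f + g).
Hypothesis P_scale : forall (a : R) c f, P c f -> P (`|a| * c) (a *: f).
Hypothesis P_ker : forall f : 'cV[R]_n, D *m f = 0 -> P 0 f.
Hypothesis P_atom : forall f : 'cV[R]_n, D *m f != 0 -> exists x : 'cV[R]_n,
  [/\ D *m x != 0, forall i, (D *m f) i 0 = 0 -> (D *m x) i 0 = 0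
    & P (l1norm (D *m x)) x].

(** Induction on the support of [D *m f].  The costs of the two pieces into
    which a step splits [f] add up to [l1norm (D *m f)] because [l1norm] is affine on
    the segment along which no coordinate changes sign. *)
Lemma conformal_decomposition f : P (l1norm (D *m f)) f.
Proof.
pose supp (f : 'cV[R]_n) := [set i | (D *m f) i 0 != 0]%SET.
have [N] := ubnP #|supp f|; elim: N f => // N IHN f; rewrite ltnS => leN.
have [Df0|Df0] := eqVneq (D *m f) 0; first by rewrite Df0 l1norm0; apply: P_ker.
(* From [f], move along [y] until a nonzero coordinate of [D *m f] first
   vanishes. *)
have step (y : 'cV[R]_n) : (forall i, (D *m f) i 0 = 0 -> (D *m y) i 0 = 0) ->
    (exists i, (D *m f) i 0 * (D *m y) i 0 < 0) ->
  exists2 t, 0 < t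
    & P (l1norm (D *m f) + t * slope (D *m y) (D *m f)) (f + t *: y).
  move=> supp_y [i /exit_time[t t0 [same_sign [k fk0 fk]]]]; exists t => //.
  have Dfy : D *m (f + t *: y) = D *m f + t *: (D *m y).
    by rewrite mulmxDr scalemxAr.
  rewrite -l1norm_line // -Dfy; apply: IHN; apply: leq_trans leN.
  apply/proper_card/properP; split.
    apply/fintype.subsetP => j; rewrite !inE Dfy; apply: contra_neq => fj0.
    by rewrite mxE fj0 add0r mxE supp_y // mulr0.
  by exists k; rewrite inE // Dfy mxE [X in _ + X]mxE fk eqxx.
(* Up to sign, the atom makes the backward move possible. *)
have [x [suppx Px [i xi]]] : exists x : 'cV[R]_n,
    [/\ forall i, (D *m f) i 0 = 0 -> (D *m x) i 0 = 0, P (l1norm (D *m x)) x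
      & exists i, (D *m f) i 0 * (D *m - x) i 0 < 0].
  have [x [Dx0 suppx Px]] := P_atom Df0.
  have [i xi] : exists i, (D *m x) i 0 != 0.
    apply/existsP; apply: contraNT Dx0 => /existsPn x0; apply/eqP/colP => i.
    by rewrite [RHS]mxE; apply/eqP; rewrite -[_ == _]negbK.
  have fi : (D *m f) i 0 != 0 by apply: contra_neq xi => /suppx.
  have [s0|s0] := ltP ((D *m f) i 0 * (D *m x) i 0) 0.
    exists (- x); split=> [j /suppx xj||]; last by exists i; rewrite opprK.
      by rewrite mulmxN mxE xj oppr0.
    rewrite mulmxN -scaleN1r l1normZ -[X in P _ X]scaleN1r; exact: P_scale.
  exists x; split=> //; exists i; rewrite mulmxN [X in _ * X]mxE mulrN oppr_lt0.
  by rewrite lt_def s0 mulf_neq0.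
have suppNx j : (D *m f) j 0 = 0 -> (D *m - x) j 0 = 0.
  by move=> /suppx xj; rewrite mulmxN mxE xj oppr0.
have [t1 t1_gt0] := step (- x) suppNx (ex_intro _ i xi).
rewrite mulmxN slopeN scalerN => P1.
have [/existsP xneg|/existsPn xpos] :=
    boolP [exists i, (D *m f) i 0 * (D *m x) i 0 < 0].
  (* Both moves are possible: [f] divides the segment between their end points
     in the ratio [t1 : t2], and the slopes cancel. *)
  have [t2 t2_gt0 P2] := step x suppx xneg.
  have t0 : t1 + t2 != 0 by rewrite gt_eqF // addr_gt0.
  have := P_add (P_scale (t2 / (t1 + t2)) P1) (P_scale (t1 / (t1 + t2)) P2).
  rewrite !ger0_norm ?divr_ge0 ?addr_ge0 ?ltW //.
  congr P; first by field.
  rewrite !scalerDr -scaleNr !scalerA addrACA -!scalerDl.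
  rewrite [X in X *: f + _](_ : _ = 1); last by field.
  rewrite scale1r [X in X *: x](_ : _ = 0); last by field.
  by rewrite scale0r addr0.
(* Otherwise [D *m x] has the signs of [D *m f], so the backward move lowers the
   norm by exactly the cost of the multiple of [x] that it subtracts. *)
have slopex : slope (D *m x) (D *m f) = l1norm (D *m x).
  apply: eq_bigr => j _; have := xpos j; have := suppx j; rewrite -leNgt.
  case: (ltrgt0P ((D *m f) j 0)) => [fj|fj|->] supp_j.
  - by rewrite pmulr_rge0 // => /ger0_norm ->; rewrite gtr0_sg // mul1r.
  - by rewrite nmulr_rge0 // => /ler0_norm ->; rewrite ltr0_sg // mulN1r.
  - by rewrite supp_j // !mulr0 normr0.
have := P_add P1 (P_scale t1 Px).
by rewrite subrK gtr0_norm // slopex mulrN subrK.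
Qed.

End Decomposition.

(** * Pruning *)

Section Pruning.
Variables (R : realType) (n : nat).

Lemma prunes_to_sub (s u : seq 'cV[R]_n) : prunes_to s u -> {subset u <= s}.
Proof.
elim=> [? _ ? //|_ t v [s1 [s2 [x [-> -> _]]]] _ IH y /IH].
by rewrite !mem_cat inE => /orP[->|->]; rewrite ?orbT.
Qed.

(** Read backwards, pruning only adds points of the symmetric convex hull of the
    current columns, which stay in any symmetric convex set [C]. *)
Lemma prunes_to_hull (C : set 'cV[R]_n) (s u : seq 'cV[R]_n) :
    (forall x, C x -> C (- x)) -> (forall x, conv_hull C x -> C x) ->
    prunes_to s u ->
  {in u, forall x, C x} -> {in s, forall x, C x}.
Proof.
move=> C_opp C_hull; elim=> [//|_ t v [s1 [s2 [x [-> tE xhull]]]] _ IH Cv y].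
have Ct := IH Cv.
rewrite mem_cat inE orbCA -mem_cat -tE => /orP[/eqP->|/Ct//].
apply: C_hull; have [N [w [z [w0 w1 tz xE]]]] := xhull.
exists N, w, z; split=> // i; have [/Ct//|/Ct/C_opp] := tz i.
by rewrite opprK.
Qed.

End Pruning.

(** * Representations by unpenalized and penalized columns *)

Section Synthesis.
Variables (R : realType) (n k q : nat) (J : 'M[R]_(n, k)) (X : 'M[R]_(n, q)).

Definition synthesizable (c : R) (f : 'cV[R]_n) : Prop :=
  exists2 b : 'cV[R]_(k + q), row_mx J X *m b = f & l1norm (dsubmx b) <= c.

Lemma synthesizable_add c d f g :
  synthesizable c f -> synthesizable d g -> synthesizable (c + d) (f + g).
Proof.
move=> [a <- ac] [b <- bd]; exists (a + b); first by rewrite mulmxDr.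
by rewrite linearD (le_trans (ler_l1normD _ _)) // lerD.
Qed.

Lemma synthesizable_scale a c f :
  synthesizable c f -> synthesizable (`|a| * c) (a *: f).
Proof.
move=> [b <- bc]; exists (a *: b); first by rewrite scalemxAr.
by rewrite linearZ l1normZ ler_wpM2l.
Qed.

Lemma synthesizable_unpenalized (a : 'cV[R]_k) : synthesizable 0 (J *m a).
Proof.
by exists (col_mx a 0); rewrite ?mul_row_col ?mulmx0 ?addr0 // col_mxKd l1norm0.
Qed.

Lemma synthesizable_column j : synthesizable 1 (col j X).
Proof.
exists (col_mx 0 (delta_mx j 0)).
  by rewrite mul_row_col mulmx0 add0r colE.
rewrite col_mxKd /l1norm (bigD1 j) //= big1 => [|i /negPf ij].
  by rewrite mxE !eqxx addr0 normr1.
by rewrite mxE ij normr0.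
Qed.

Lemma synthesizable_hull f :
  conv_hull [set g | synthesizable 1 g] f -> synthesizable 1 f.
Proof.
move=> [N [w [v [w0 w1 v1 ->]]]]; rewrite -[X in synthesizable X]w1.
elim/big_rec2: _ => [|i f' c' _ IH].
  by have := synthesizable_unpenalized 0; rewrite mulmx0.
by apply: synthesizable_add IH; have := synthesizable_scale (w i) (v1 i);
    rewrite ger0_norm // mulr1.
Qed.

End Synthesis.

(** * Existence and uniqueness of the minimizer *)

Section Minimizer.
Import numFieldNormedType.Exports.
Variable R : realType.

Lemma continuous_sumr (T : topologicalType) (I : Type) (s : seq I)
    (F : I -> T -> R) :
  (forall i, continuous (F i)) -> continuous (fun x => \sum_(i <- s) F i x).
Proof.
by move=> cF; apply: continuous_big => //; apply: (@add_continuous R^o).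
Qed.

Lemma continuous_addr (T : topologicalType) (f g : T -> R) :
  continuous f -> continuous g -> continuous (fun x => f x + g x).
Proof. by move=> cf cg x; apply: (cvgD (cf x) (cg x)). Qed.

Lemma continuous_mulr (T : topologicalType) (f g : T -> R) :
  continuous f -> continuous g -> continuous (fun x => f x * g x).
Proof. by move=> cf cg x; apply: (cvgM (cf x) (cg x)). Qed.

Lemma sqnormn_ge0 n (v : 'cV[R]_n) : 0 <= sqnormn v.
Proof. by rewrite divr_ge0 ?sumr_ge0 // => i _; rewrite sqr_ge0. Qed.

Lemma sqnormn_coord n (v : 'cV[R]_n) i : v i 0 ^+ 2 <= n%:R * sqnormn v.
Proof.
have n0 : n%:R != 0 :> R.
  by rewrite pnatr_eq0 -lt0n (leq_ltn_trans _ (ltn_ord i)).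
rewrite /sqnormn mulrC divfK // (bigD1 i) //= lerDl.
by apply: sumr_ge0 => j _; apply: sqr_ge0.
Qed.

(** The parallelogram identity: the term in [u - v] measures the strict
    convexity. *)
Lemma sqnormn_midpoint n (u v : 'cV[R]_n) :
  sqnormn (2^-1 *: (u + v))
    = 2^-1 * (sqnormn u + sqnormn v) - 4^-1 * sqnormn (u - v).
Proof.
rewrite /sqnormn -mulrDl !mulrA -mulrBl -big_split /= !mulr_sumr -sumrB.
congr (_ / _); apply: eq_bigr => i _; rewrite !mxE.
by field.
Qed.

Variables (m n : nat) (D : 'M[R]_(m, n)) (Y : 'cV[R]_n) (c : R).
Hypothesis c_ge0 : 0 <= c.

Let objective (f : 'cV[R]_n) : R := sqnormn (Y - f) + c * l1norm (D *m f).

Lemma objective_continuous : continuous (fun v : 'rV[R]_n => objective v^T).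
Proof.
have -> : (fun v : 'rV[R]_n => objective v^T) = fun v =>
    (\sum_i (Y i 0 - v 0 i) ^+ 2) * n%:R^-1
    + c * \sum_i `|\sum_j D i j * v 0 j|.
  apply: boolp.funext => v; congr (_ / _ + c * _); apply: eq_bigr => i _.
    by rewrite !mxE.
  by rewrite mxE; congr `|_|; apply: eq_bigr => j _; rewrite mxE.
apply: continuous_addr; apply: continuous_mulr; try exact: cst_continuous.
  apply: continuous_sumr => i; apply: continuous_mulr;
    by apply: continuous_addr; [exact: cst_continuous|
      move=> v; apply: continuousN; exact: coord_continuous].
apply: continuous_sumr => i v.
apply: continuous_comp; last exact: norm_continuous.
apply: continuous_sumr => j.
by apply: continuous_mulr; [exact: cst_continuous|exact: coord_continuous].
Qed.

Lemma objective_min : exists f, argmin objective f.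
Proof.
(* If [B < `|Y i 0 - f i 0|], its square also exceeds [B], as [1 <= B]; so
   [sqnormn (Y - f)] alone exceeds [objective Y]. *)
pose B := 1 + n%:R * objective Y.
have Y0 : 0 <= objective Y.
  by rewrite addr_ge0 ?sqnormn_ge0 // mulr_ge0 ?l1norm_ge0.
have B1 : 1 <= B by rewrite lerDl mulr_ge0.
pose box := [set v : 'rV[R]_n | forall i, `[Y i 0 - B, Y i 0 + B] (v ord0 i)].
have boxP (f : 'cV[R]_n) : box f^T <-> forall i, `|Y i 0 - f i 0| <= B.
  by split=> fi i; have := fi i; rewrite /= mxE in_itv /= distrC ler_distl.
have cbox : compact box.
  apply: (@rV_compact _ _ (fun i => `[Y i 0 - B, Y i 0 + B])) => i.
  exact: segment_compact.
have Ybox : box Y^T by apply/boxP => i; rewrite subrr normr0 (le_trans ler01).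
have [v _ vmin] := compact_EVT_min (ex_intro _ _ Ybox) cbox
  (continuous_subspaceT objective_continuous).
exists v^T => f.
have [/boolp.asboolP fbox|] := boolP (boolp.asbool (box f^T)).
  by have := vmin f^T; rewrite trmxK; apply; rewrite inE.
move=> /boolp.asboolPn; rewrite boxP => /boolp.existsNP[i /negP].
rewrite -ltNge => Bi; have /le_trans : objective v^T <= objective Y.
  by have := vmin Y^T; rewrite trmxK; apply; rewrite inE.
apply; suff : objective Y <= sqnormn (Y - f).
  by move=> /le_trans; apply; rewrite lerDl mulr_ge0 ?l1norm_ge0.
have n0 : 0 < n%:R :> R by rewrite ltr0n (leq_ltn_trans _ (ltn_ord i)).
rewrite -(ler_pM2l n0); apply: le_trans (sqnormn_coord _ i).
rewrite mxE [(- f) i 0]mxE -real_normK ?num_real //.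
apply: le_trans (_ : B <= _); first by rewrite lerDr.
apply: le_trans (ltW Bi) _; rewrite expr2 ler_peMr //.
by rewrite (le_trans B1) // ltW.
Qed.

(** At the midpoint of two minimizers the objective would be smaller by at least
    a quarter of [sqnormn] of their difference. *)
Lemma objective_min_unique f g :
  argmin objective f -> argmin objective g -> f = g.
Proof.
move=> fmin gmin.
have fg : objective f = objective g by apply/le_anti; rewrite fmin gmin.
pose h := 2^-1 *: (f + g).
have Yh : Y - h = 2^-1 *: ((Y - f) + (Y - g)).
  by apply/colP => i; rewrite !mxE; field.
have Dh : l1norm (D *m h) <= 2^-1 * (l1norm (D *m f) + l1norm (D *m g)).
  rewrite -scalemxAr mulmxDr l1normZ ger0_norm ?invr_ge0 //.
  by rewrite ler_wpM2l ?invr_ge0 // ler_l1normD.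
have := fmin h; have := ler_wpM2l c_ge0 Dh.
move: fg; rewrite /objective Yh sqnormn_midpoint => fg cDh hmin.
have s0 : sqnormn (g - f) <= 0.
  have -> : g - f = (Y - f) - (Y - g) by apply/colP => i; rewrite !mxE; ring.
  lra.
apply/colP => i; apply/eqP; rewrite eq_sym -subr_eq0 -sqrf_eq0.
rewrite eq_le sqr_ge0 andbT.
have := sqnormn_coord (g - f) i; rewrite mxE [(- f) i 0]mxE => /le_trans -> //.
by rewrite mulr_ge0_le0.
Qed.

End Minimizer.

(** * The dictionary *)

Section Dictionary.
Variables (R : realType) (m n r q : nat) (D : 'M[R]_(m, n)).
Variables (J : 'M[R]_(n, n - r)) (X : 'M[R]_(n, q)).
Hypotheses (rankD : \rank D = r) (dictX : is_dictionary D J X).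

Lemma rescale_atomK (x : 'cV[R]_n) :
  D *m x != 0 -> l1norm (D *m x) *: rescale D x = x.
Proof.
move=> Dx0; rewrite scalerA divff ?scale1r //.
by apply: contra_neq Dx0 => /l1norm_eq0.
Qed.

(** An inequality, so that it also covers [D *m x = 0], where the rescaled
    vector is zero. *)
Lemma l1norm_rescale_le1 (x : 'cV[R]_n) : l1norm (D *m rescale D x) <= 1.
Proof.
rewrite /rescale -scalemxAr l1normZ ger0_norm ?invr_ge0 ?l1norm_ge0 //.
have [->|x0] := eqVneq (l1norm (D *m x)) 0; first by rewrite mulr0.
by rewrite mulVf.
Qed.

(** The rows of a basis [T] span those of [D], and [D_T *m J = 0] is a block of
    the identity [B *m B^-1 = 1]. *)
Lemma dictionary_unpenalized_ker : D *m J = 0.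
Proof.
have [A [Xt [_ [_ invX _ _]]]] := dictX.
have [T Tbase _] := row_bases_extend finset.set0 rankD.
have [_ TJ _] := inverse_blocksP (invX T Tbase).
apply/matrixP => i j; rewrite [RHS]mxE.
have /(row_bases_ker rankD Tbase) : row_submx D T *m col j J = 0.
  by rewrite colE mulmxA TJ mul0mx.
by move=> /colP/(_ i); rewrite colE mulmxA -colE !mxE.
Qed.

(** The triangle inequality over the columns of [X], each of which costs at most
    1, while those of [J] cost nothing. *)
Lemma dictionary_analysis_le (b : 'cV[R]_(n - r + q)) :
  l1norm (D *m (row_mx J X *m b)) <= l1norm (dsubmx b).
Proof.
have colX j : l1norm (D *m col j X) <= 1.
  have [A [Xt [s [_ _ _ pruneX]]]] := dictX.
  have /(prunes_to_sub pruneX)/mapP[x _ ->] : col j X \in columns X.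
    by apply: map_f; rewrite mem_enum.
  exact: l1norm_rescale_le1.
rewrite -[b in X in X <= _]vsubmxK mul_row_col mulmxDr !mulmxA.
rewrite dictionary_unpenalized_ker mul0mx add0r.
have -> : D *m X *m dsubmx b = \sum_j dsubmx b j 0 *: (D *m col j X).
  apply/colP => i; rewrite mxE summxE; apply: eq_bigr => j _.
  by rewrite colE mulmxA -colE !mxE mulrC.
apply: le_trans (_ : \sum_j l1norm (dsubmx b j 0 *: (D *m col j X)) <= _).
  elim/big_rec2: _ => [|j c v _]; first by rewrite l1norm0.
  by move=> IH; rewrite (le_trans (ler_l1normD _ _)) // lerD2l.
by apply: ler_sum => j _; rewrite l1normZ ler_piMr.
Qed.

(** The vectors synthesizable at cost 1 form a symmetric convex set that contains
    the columns of [X], hence also the pruned ones, hence all the rescaled atoms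
    that the decomposition of [f] needs. *)
Lemma dictionary_synthesis f : synthesizable J X (l1norm (D *m f)) f.
Proof.
have [A [Xt [s [_ invX sE pruneX]]]] := dictX.
have atomP x : x \in map (rescale D) s -> synthesizable J X 1 x.
  apply: (prunes_to_hull (C := synthesizable J X 1)) pruneX _ x.
  - by move=> x /(synthesizable_scale (-1)); rewrite normrN1 mul1r scaleN1r.
  - exact: synthesizable_hull.
  - by move=> _ /mapP[j _ ->]; apply: synthesizable_column.
apply: conformal_decomposition => {f}.
- by move=> c d f g; apply: synthesizable_add.
- by move=> a c f; apply: synthesizable_scale.
- move=> f Df0; have [T Tbase _] := row_bases_extend finset.set0 rankD.
  have [JA _ _] := inverse_blocksP (invX T Tbase).
  have Tf0 : row_submx D T *m f = 0.
    by apply/eqP/row_submx_mul0P => i _; rewrite Df0 mxE.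
  (* This is [J *m A + Xt T *m D_T = 1] applied to [f]. *)
  have -> : f = J *m (A *m f).
    by rewrite -[LHS]mul1mx -JA mulmxDl -!mulmxA Tf0 mulmx0 addr0.
  exact: synthesizable_unpenalized.
move=> f /(exists_atom_in_support rankD invX)[T Tbase [j [Dx0 supp_x]]].
exists (col j (Xt T)); split=> //.
rewrite -[X in synthesizable _ _ _ X](rescale_atomK Dx0).
have := @synthesizable_scale _ _ _ _ J X (l1norm (D *m col j (Xt T))) 1.
rewrite ger0_norm ?l1norm_ge0 // mulr1; apply; apply/atomP/map_f.
rewrite (perm_mem sE); apply/flattenP; exists (columns (Xt T)).
  by apply: map_f; rewrite mem_enum.
by apply: map_f; rewrite mem_enum.
Qed.

End Dictionary.

Unset Implicit Arguments.

Theorem corollary4p2 (R : realType) (m n r q : nat) (D : 'M[R]_(m, n))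
    (rankD : \rank D = r) (le_r : (r <= minn m n)%N)
    (J : 'M[R]_(n, n - r)) (X : 'M[R]_(n, q)) (dictX : is_dictionary D J X)
    (Y : 'cV[R]_n) (lambda : R) (lambda_gt0 : 0 < lambda) :
  exists fA : 'cV[R]_n,
    argmin (fun f : 'cV[R]_n => sqnormn (Y - f) + 2 * lambda * l1norm (D *m f))
      = [set fA] /\
    [set row_mx J X *m beta | beta in
       argmin (fun beta : 'cV[R]_(n - r + q) =>
         sqnormn (Y - row_mx J X *m beta) + 2 * lambda * l1norm (dsubmx beta))]
      = [set fA].
Proof.
have c_ge0 : 0 <= 2 * lambda by rewrite mulr_ge0 // ltW.
have [fA fA_min] := objective_min D Y c_ge0.
have analysisE f : argmin (fun f : 'cV[R]_n =>
    sqnormn (Y - f) + 2 * lambda * l1norm (D *m f)) f -> f = fA.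
  by move=> f_min; apply: objective_min_unique c_ge0 _ _ f_min fA_min.
have le_synthesis b : sqnormn (Y - row_mx J X *m b)
      + 2 * lambda * l1norm (D *m (row_mx J X *m b))
    <= sqnormn (Y - row_mx J X *m b) + 2 * lambda * l1norm (dsubmx b).
  by rewrite lerD2l ler_wpM2l // dictionary_analysis_le.
have [bA bAE bA_le] := dictionary_synthesis rankD dictX fA.
have synthesis_le : sqnormn (Y - row_mx J X *m bA)
      + 2 * lambda * l1norm (dsubmx bA)
    <= sqnormn (Y - fA) + 2 * lambda * l1norm (D *m fA).
  by rewrite bAE lerD2l ler_wpM2l.
exists fA; split; apply/seteqP; split=> [f|_ ->].
- exact: analysisE.
- exact: fA_min.
- move=> [b b_min <-]; apply: analysisE => g.
  exact: le_trans (le_synthesis b)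
    (le_trans (b_min bA) (le_trans synthesis_le (fA_min g))).
- exists bA => // b; apply: le_trans synthesis_le _.
  exact: le_trans (fA_min _) (le_synthesis b).
Qed.
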